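(* Let $d\ge 1$ be an integer and let $\lambda\in[0,1]$. Let $g\in L^1(\mathbb{R}^d)$ be a non-negative radial decreasing function. Then for every $t>0$, $$\big|\{x\in\mathbb{R}^d : M_\lambda g(x)>t\}\big|\le \frac{(1+\lambda)^d}{t}\,\|g\|_1 .$$ Furthermore, the constant $(1+\lambda)^d$ is sharp: for each $d\ge 1$ and each $\lambda\in[0,1]$, if $C$ is a real number such that $|\{x\in\mathbb{R}^d : M_\lambda g(x)>t\}|\le \frac{C}{t}\|g\|_1$ for every non-negative radial decreasing $g\in L^1(\mathbb{R}^d)$ and every $t>0$, then $C\ge (1+\lambda)^d$.
   Context: $|\cdot|$ denotes Lebesgue measure on $\mathbb{R}^d$, $\|\cdot\|$ the Euclidean norm on $\mathbb{R}^d$, and $\|g\|_1=\int_{\mathbb{R}^d}|g|\,dx$. All balls are closed Euclidean balls $B=B(c,r)=\{y\in\mathbb{R}^d:\|y-c\|\le r\}$ with radius $r>0$. For $\lambda\in[0,1]$, $\lambda B$ denotes the image of $B=B(c,r)$ under the homothety of ratio $\lambda$ centered at the center of $B$, i.e. $\lambda B=\{y:\|y-c\|\le\lambda r\}$; in particular $0B=\{c\}$. For a non-negative locally integrable function $f$ on $\mathbb{R}^d$, the almost uncentered maximal function of $f$ is $$M_\lambda f(x)=\sup_{B:\ \lambda B\ni x}\frac{1}{|B|}\int_B f\,dy ,\qquad x\in\mathbb{R}^d,$$ the supremum being over all balls $B$ with $x\in\lambda B$ (so $\lambda=0$ gives the centered and $\lambda=1$ the uncentered Hardy--Littlewood maximal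 function). A function $g$ is radial decreasing if there is a non-increasing (not necessarily strictly decreasing) function $\varphi:(0,\infty)\to[0,\infty)$ with $g(x)=\varphi(\|x\|)$ for all $x\ne 0$. *)

(* Defs.v *)
From HB Require Import structures.
From mathcomp Require Import all_boot all_order all_algebra.
From mathcomp Require Import all_classical all_reals all_analysis.

Set Implicit Arguments.
Unset Strict Implicit.
Unset Printing Implicit Defensive.

Import Order.TTheory GRing.Theory Num.Theory.
Import numFieldNormedType.Exports.

Local Open Scope classical_set_scope.
Local Open Scope ring_scope.

(* R^d with the product of the Borel sigma-algebras of its coordinates, that
   is, with its own Borel sigma-algebra. *)
Notation Rspace R d := (d.-tuple (measurableTypeR R)).

Section lebesgue_step.
Context {R : realType} {n : nat}.

Definition tcons (p : measurableTypeR R * Rspace R n) : Rspace R n.+1 :=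
  [tuple of p.1 :: p.2].

Lemma measurable_tcons : measurable_fun setT tcons.
Proof. by apply: measurable_cons. Qed.

Variable m : {sigma_finite_measure set (Rspace R n) -> \bar R}.

Definition lebesgue_step : set (Rspace R n.+1) -> \bar R :=
  pushforward (lebesgue_measure \x m)%E tcons.

Let lebesgue_step0 : lebesgue_step set0 = 0%E.
Proof. by rewrite /lebesgue_step /pushforward preimage_set0 measure0. Qed.

Let lebesgue_step_ge0 A : (0 <= lebesgue_step A)%E.
Proof. by rewrite /lebesgue_step /pushforward measure_ge0. Qed.

Let measurable_pre A : measurable A -> measurable (tcons @^-1` A).
Proof.
by move=> mA; rewrite -[X in measurable X]setTI; exact: measurable_tcons.
Qed.

Let lebesgue_step_sigma_additive : semi_sigma_additive lebesgue_step.
Proof.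
move=> F mF tF mUF; rewrite /lebesgue_step /pushforward preimage_bigcup.
apply: measure_semi_sigma_additive.
- by move=> i; exact: measurable_pre.
- apply/trivIsetP => /= i j _ _ ij; rewrite -preimage_setI.
  by move/trivIsetP : tF => /(_ _ _ _ _ ij) ->//; rewrite preimage_set0.
- by rewrite -preimage_bigcup; exact: measurable_pre.
Qed.

HB.instance Definition _ := isMeasure.Build _ _ _ lebesgue_step
  lebesgue_step0 lebesgue_step_ge0 lebesgue_step_sigma_additive.

Let tuncons (t : Rspace R n.+1) : measurableTypeR R * Rspace R n :=
  (thead t, [tuple of behead t]).

Let tunconsK : cancel tuncons tcons.
Proof. by move=> t; rewrite /tcons/= [RHS]tuple_eta; apply: val_inj. Qed.

Let tconsK : cancel tcons tuncons.
Proof.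
by move=> [a b]; rewrite /tuncons /tcons/= theadE; congr pair; apply: val_inj.
Qed.

Let measurable_tuncons : measurable_fun setT tuncons.
Proof.
apply/measurable_fun_pair; first exact: measurable_tnth.
exact: measurable_behead.
Qed.

Let lebesgue_step_sigma_finite : sigma_finite setT lebesgue_step.
Proof.
have /sigma_finiteP[F [TF ndF Foo]] := sigma_finiteT (@lebesgue_measure R).
have /sigma_finiteP[G [TG ndG Goo]] := sigma_finiteT m.
exists (fun k => tuncons @^-1` (F k `*` G k)).
  rewrite -preimage_bigcup (_ : \bigcup_k _ = setT) ?preimage_setT//.
  rewrite -subTset => -[x y] _.
  have [i _ Fx] : (\bigcup_i F i) x by rewrite -TF.
  have [j _ Gy] : (\bigcup_i G i) y by rewrite -TG.
  exists (maxn i j) => //; split.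
    by move: x Fx; exact/subsetPset/ndF/leq_maxl.
  by move: y Gy; exact/subsetPset/ndG/leq_maxr.
move=> k; have [mF Fk] := Foo k; have [mG Gk] := Goo k; split.
  rewrite -[X in measurable X]setTI; apply: measurable_tuncons => //.
  exact: measurableX.
rewrite /lebesgue_step /pushforward -comp_preimage.
rewrite (_ : _ \o _ = id); last by apply/funext => x /=; rewrite tconsK.
by rewrite preimage_id product_measure1E// lte_mul_pinfty// ge0_fin_numE.
Qed.

HB.instance Definition _ := Measure_isSigmaFinite.Build _ _ _ lebesgue_step
  lebesgue_step_sigma_finite.

End lebesgue_step.

(* The d-fold product of the Lebesgue measure of the line. It is only
   meaningful on Borel sets; see lebesgue_box below for its values on boxes. *)
Fixpoint lebesgue (R : realType) (d : nat) :
    {sigma_finite_measure set (Rspace R d) -> \bar R} :=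
  if d is n.+1 then lebesgue_step (lebesgue R n) else dirac [tuple].

Section maximal_function.
Context {R : realType} {d : nat}.
Implicit Types (x y c : Rspace R d) (r lam : R) (f g : Rspace R d -> R).

(* The library norm on finite products is the sup norm. *)
Definition enorm x : R := Num.sqrt (\sum_(i < d) (tnth x i : R) ^+ 2).

Definition tsub x y : Rspace R d := [tuple (tnth x i - tnth y i : R) | i < d].

Definition cball c r : set (Rspace R d) := [set y | enorm (tsub y c) <= r].

Local Open Scope ereal_scope.

Definition average f (B : set (Rspace R d)) : \bar R :=
  (lebesgue R d B)^-1 * \int[lebesgue R d]_(y in B) (f y)%:E.

(* The supremum ranges over the closed balls B = cball c r with r > 0 such that
   x belongs to lam B = cball c (lam * r). *)
Definition maximal lam f x : \bar R :=
  ereal_sup [set v | exists c r,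
    [/\ (0 < r)%R, cball c (lam * r)%R x & v = average f (cball c r)]].

Definition norm1 g : \bar R := \int[lebesgue R d]_y `|(g y)%:E|.

End maximal_function.

(* phi is only constrained on the positive half-line, and g is free at 0. *)
Definition radial_decreasing (R : realType) (d : nat) (g : Rspace R d -> R) :=
  exists phi : R -> R,
    [/\ forall s, 0 < s -> 0 <= phi s,
        forall s s', 0 < s -> s <= s' -> phi s' <= phi s &
        forall x, x <> [tuple (0 : R) | _ < d] -> g x = phi (enorm x)].

Lemma lebesgue_box (R : realType) (d : nat) (a b : Rspace R d) :
  (forall i, (tnth a i : R) <= tnth b i) ->
  lebesgue R d [set x | forall i, tnth x i \in `[(tnth a i : R), tnth b i]]
  = (\prod_(i < d) ((tnth b i : R) - tnth a i))%:E.
Proof.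
elim: d a b => [|d IH] a b ab.
  rewrite big_ord0 (_ : [set _ | _] = setT) ?[LHS]diracT//.
  by apply/seteqP; split => // x _ [].
rewrite /= /lebesgue_step /pushforward.
have sl (t : Rspace R d.+1) (i : 'I_d) :
  tnth t (lift ord0 i) = tnth [tuple of behead t] i.
  by rewrite [in LHS](tuple_eta t) tnthS.
rewrite [X in (_ \x _)%E X](_ : _ =
    [set` `[(thead a : R), thead b]] `*`
    [set x | forall i, tnth x i \in `[(tnth [tuple of behead a] i : R),
                                      tnth [tuple of behead b] i]]).
  rewrite product_measure1E//; last first.
    rewrite (_ : [set _ | _] = \bigcap_(i in @setT 'I_d)
        ((@tnth _ _ ^~ i) @^-1` `[(tnth [tuple of behead a] i : R),
                                 tnth [tuple of behead b] i])).
      apply: fin_bigcap_measurable => // i _.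
      rewrite -[X in measurable X]setTI; apply: measurable_tnth => //.
    by apply/seteqP; split => [x h i _|x h i]; [exact: h | exact: (h i I)].
  rewrite IH; last by move=> i; rewrite -!sl.
  rewrite big_ord_recl EFinM.
  under [in RHS]eq_bigr do rewrite !sl.
  congr (_ * _)%E.
  have := ab ord0; rewrite -!/(thead _) => hab.
  transitivity (lebesgue_measure (`[(thead a : R), thead b]%classic : set R)) => //.
  rewrite lebesgue_measure_itv/= lte_fin lt_neqAle hab andbT.
  by have [->|] := eqVneq (thead a : R) (thead b); rewrite ?subrr.
have bh x (y : Rspace R d) : [tuple of behead (tcons (x, y))] = y.
  exact: val_inj.
apply/seteqP; split => -[x y] /=.
  move=> h; split => [|i]; first exact: (h ord0).
  by have := h (lift ord0 i); rewrite !sl bh.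
move=> [/= h0 h] i; have [->|i0] := eqVneq i ord0; first exact: h0.
case: (unliftP ord0 i) i0 => [j ->|->]; last by rewrite eqxx.
by move=> _; rewrite !sl bh; exact: h.
Qed.

(* Main.v *)
(* Upper bound: if [x] lies in [lam B] with [B = B(c, r)] and
   [S = |x| / (1 + lam)], then the integral of [g] over [B] is at most
   [(r / S)^d |g|_1], hence [M_lam g x <= (1 + lam)^d |g|_1 / |B(0, |x|)|], and
   the level set lies in a ball of the right volume. This is clear if [r >= S];
   otherwise [|c| >= S], and by the layer-cake formula it suffices to compare
   the superlevel sets of [g], i.e. balls [B(0, rho)]. If [rho >= S] the bound
   is [|B| = (r / S)^d |B(0, S)|]; if [rho <= S], then [B] meets
   [B(0, rho)] inside the ball of centre [(rho / S)^2 c] and radius [r rho / S].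
   Sharpness: test on the indicator [g] of the unit ball with [t = (rho + 2)^-d]
   and let [rho] go to infinity; if [|x| <= (1 + lam) rho], the ball of centre
   [x / (1 + lam)] and radius [rho + 1] contains the unit ball. *)

Require Import Defs.
From mathcomp Require Import all_boot all_order all_algebra.
From mathcomp Require Import all_classical all_reals all_analysis.
From mathcomp Require Import measurable_realfun ring lra.

Import Order.TTheory GRing.Theory Num.Theory.
Import numFieldNormedType.Exports.
Local Open Scope classical_set_scope.
Local Open Scope ring_scope.

(** * Monotonicity and affine scaling of the product Lebesgue measure *)

(** A nonnegative integral is a supremum over the simple functions below the integrand, hence
    monotone even for non-measurable integrands, such as the section functions of arbitrary sets in
    [le_lebesgue]. *)
Lemma ge0_le_integralT d (T : measurableType d) (R : realType)
    (mu : {measure set T -> \bar R}) (f g : T -> \bar R) :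
  (forall x, 0 <= f x)%E -> (forall x, f x <= g x)%E ->
  (\int[mu]_x f x <= \int[mu]_x g x)%E.
Proof.
move=> f0 fg; rewrite !ge0_integralTE//; last first.
  by move=> x; exact: le_trans (fg x).
by apply: ereal_sup_le => _ [h hf <-]; exists h => // x; exact: le_trans (fg x).
Qed.

(* Arbitrary sets are allowed so that the measurability of the level sets of
   [maximal] never has to be established. *)
Lemma le_lebesgue (R : realType) (d : nat) (A B : set (Rspace R d)) :
  A `<=` B -> (lebesgue R d A <= lebesgue R d B)%E.
Proof.
elim: d A B => [|d IH] A B AB /=.
  rewrite /dirac !indicE lee_fin ler_nat.
  have [/set_mem/AB/mem_set->|] := boolP ([tuple] \in A) => //.
rewrite /lebesgue_step /pushforward /product_measure1.
apply: ge0_le_integralT => x /=; first exact: measure_ge0.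
by apply: IH => y; rewrite /xsection/= !inE; exact: AB.
Qed.

(** As a function of [A], the right-hand side is a measure that has the right value on half-open
    intervals; uniqueness of Lebesgue measure concludes. *)
Lemma lebesgue_measure_affine (R : realType) (a s : R)
    (A : set (measurableTypeR R)) : 0 < s -> measurable A ->
  lebesgue_measure A =
  (s%:E * lebesgue_measure ((fun x => (a + s * x)%R) @^-1` A))%E.
Proof.
move=> s0 mA.
pose phi (x : measurableTypeR R) : measurableTypeR R := a + s * x.
have mphi : measurable_fun setT phi.
  by apply: measurable_funD => //; exact: measurable_funM.
pose m := mscale (NngNum (ltW s0)) (pushforward lebesgue_measure phi).
rewrite [RHS](_ : _ = m mphi A)//.
apply: (@lebesgue_measure_unique R (m mphi)) => // _ [[u v]] _ <- /=.
rewrite /m /mscale/= /pushforward.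
rewrite (_ : _ @^-1` _ = `](u - a) / s, (v - a) / s]%classic); last first.
  apply/seteqP; split => x /=; rewrite !in_itv/= ltr_pdivrMr// ler_pdivlMr//;
    by rewrite ltrBlDl lerBrDl mulrC.
rewrite !lebesgue_measure_itv/= !lte_fin ltr_pM2r ?invr_gt0// ltrD2r.
case: ifPn => _; last by rewrite mule0.
rewrite -!EFinB -EFinM; congr EFin; field; exact: lt0r_neq0.
Qed.

Lemma ge0_integral_affine (R : realType) (a s : R)
    (F : measurableTypeR R -> \bar R) : 0 < s -> measurable_fun setT F ->
  (forall x, 0 <= F x)%E ->
  (\int[lebesgue_measure]_x F x =
   s%:E * \int[lebesgue_measure]_x F (a + s * x)%R)%E.
Proof.
move=> s0 mF F0.
pose phi (x : measurableTypeR R) : measurableTypeR R := a + s * x.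
have mphi : measurable_fun setT phi.
  by apply: measurable_funD => //; exact: measurable_funM.
pose nu := mscale (NngNum (ltW s0)) (pushforward lebesgue_measure phi).
transitivity (\int[nu mphi]_x F x)%E.
  by apply: eq_measure_integral => B mB _; exact: lebesgue_measure_affine.
by rewrite ge0_integral_mscale//= ge0_integral_pushforward// preimage_setT.
Qed.

Definition taffine {R : realType} {d : nat} (a : Rspace R d) (s : R)
  (x : Rspace R d) : Rspace R d :=
  [tuple (tnth a i + s * tnth x i : R) | i < d].

Lemma measurable_taffine (R : realType) (d : nat) (a : Rspace R d) (s : R) :
  measurable_fun setT (taffine a s).
Proof.
apply/measurable_fun_tnthP => i.
rewrite (_ : _ \o _ = fun x => (tnth a i + s * tnth x i : R)); last first.
  by apply/funext => x /=; rewrite tnth_mktuple.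
apply: measurable_funD => //; apply: measurable_funM => //.
exact: measurable_tnth.
Qed.

Lemma tnth_lift0 (T : Type) (d : nat) (t : d.+1.-tuple T) (i : 'I_d) :
  tnth t (lift ord0 i) = tnth [tuple of behead t] i.
Proof. by rewrite [in LHS](tuple_eta t) tnthS. Qed.

(** Induction on the dimension: the change of variable in the first coordinate contributes one
    factor [s], and the sections contribute [s ^+ d] by the induction hypothesis. *)
Lemma lebesgue_affine (R : realType) (d : nat) (a : Rspace R d) (s : R)
    (A : set (Rspace R d)) : 0 < s -> measurable A ->
  lebesgue R d A = ((s ^+ d)%:E * lebesgue R d (taffine a s @^-1` A))%E.
Proof.
move=> s0; elim: d a A => [|d IH] a A mA.
  rewrite expr0 mul1e; congr (lebesgue R 0 _); apply/seteqP.
  by split=> x; rewrite /= (tuple0 x) (tuple0 (taffine _ _ _)).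
rewrite /= /lebesgue_step /pushforward /product_measure1.
have mtA : measurable (@tcons R d @^-1` A).
  by rewrite -[X in measurable X]setTI; exact: measurable_tcons.
have mtA' : measurable (@tcons R d @^-1` (taffine a s @^-1` A)).
  rewrite -[X in measurable X]setTI; apply: measurable_tcons => //.
  by rewrite -[X in measurable X]setTI; exact: measurable_taffine.
pose F x := lebesgue R d (xsection (tcons @^-1` A) x).
have mF : measurable_fun setT F by exact: measurable_fun_xsection.
rewrite (@ge0_integral_affine _ (tnth a ord0) s)//.
pose G x := lebesgue R d (xsection (tcons @^-1` (taffine a s @^-1` A)) x).
have FG x : F (tnth a ord0 + s * x)%R = ((s ^+ d)%:E * G x)%E.
  rewrite /F (IH [tuple of behead a]); last exact: measurable_xsection.
  congr (_ * lebesgue R d _)%E; apply/seteqP.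
  have E (y : Rspace R d) : taffine a s (tcons (x, y)) =
      tcons (tnth a ord0 + s * x, taffine [tuple of behead a] s y).
    apply: eq_from_tnth => i; rewrite tnth_mktuple.
    case: (unliftP ord0 i) => [j|] -> //=.
    by rewrite /tcons !tnthS tnth_mktuple tnth_lift0.
  by split=> y; rewrite /xsection/= !inE/= E.
rewrite (eq_integral (fun x => (s ^+ d)%:E * G x)%E); last first.
  by move=> x _; exact: FG.
rewrite ge0_integralZl//= ?muleA -?EFinM -?exprS//.
- exact: measurable_fun_xsection.
- by rewrite lee_fin exprn_ge0// ltW.
Qed.

(** * Euclidean norm and closed balls *)

Section euclidean.
Context {R : realType} {d : nat}.
Implicit Types (x y z c : Rspace R d) (r s : R).

Definition origin : Rspace R d := [tuple (0 : R) | _ < d].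

Lemma enorm_ge0 x : 0 <= enorm x.
Proof. exact: sqrtr_ge0. Qed.

Lemma sqr_enorm x : enorm x ^+ 2 = \sum_(i < d) (tnth x i : R) ^+ 2.
Proof. by rewrite sqr_sqrtr// sumr_ge0// => i _; exact: sqr_ge0. Qed.

Lemma enorm_le x r : 0 <= r ->
  (enorm x <= r) = (\sum_(i < d) (tnth x i : R) ^+ 2 <= r ^+ 2).
Proof. by move=> r0; rewrite -sqr_enorm ler_pXn2r// nnegrE enorm_ge0. Qed.

Lemma tsubE x y i : tnth (tsub x y) i = tnth x i - tnth y i :> R.
Proof. by rewrite /tsub tnth_mktuple. Qed.

Lemma originE i : tnth origin i = 0 :> R.
Proof. by rewrite /origin tnth_mktuple. Qed.

Lemma tsubx0 x : tsub x origin = x.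
Proof. by apply: eq_from_tnth => i; rewrite tsubE originE subr0. Qed.

Lemma cball0E r : cball origin r = [set x | enorm x <= r].
Proof. by apply/seteqP; split => x; rewrite /cball/= tsubx0. Qed.

Lemma cballE c r x : 0 <= r -> cball c r x <->
  \sum_(i < d) ((tnth x i : R) - tnth c i) ^+ 2 <= r ^+ 2.
Proof.
move=> r0; rewrite /cball/= enorm_le//.
rewrite (eq_bigr (fun i => ((tnth x i : R) - tnth c i) ^+ 2))// => i _.
by rewrite tsubE.
Qed.

(** The relation z = x + y is stated coordinatewise so that it applies directly to differences such
    as [tsub x c]. *)
Lemma enorm_triangle x y z :
  (forall i, tnth z i = tnth x i + tnth y i :> R) ->
  enorm z <= enorm x + enorm y.
Proof.
move=> zE; apply/ler_addgt0Pr => e e0.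
have [x0 y0] : 0 <= enorm x /\ 0 <= enorm y by split; exact: enorm_ge0.
rewrite enorm_le; last by rewrite !addr_ge0// ltW.
(* The slack [e] makes both weights positive, so they can be divided by even when a norm
   vanishes. *)
set a := enorm x + e / 2; set b := enorm y + e / 2.
have [a0 b0] : 0 < a /\ 0 < b by rewrite /a /b; split; lra.
have -> : enorm x + enorm y + e = a + b by rewrite /a /b; lra.
(* Cauchy-Schwarz in the form [(u + v)^2 <= (a + b) (u^2 / a + v^2 / b)]. *)
apply: (@le_trans _ _ (\sum_(i < d)
    ((a + b) / a * (tnth x i : R) ^+ 2 + (a + b) / b * (tnth y i : R) ^+ 2))).
  apply: ler_sum => i _; rewrite zE -subr_ge0.
  set u : R := tnth x i; set v : R := tnth y i.
  rewrite (_ : _ - _ = (b * u - a * v) ^+ 2 / (a * b)); last first.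
    by field; rewrite !lt0r_neq0.
  by rewrite divr_ge0 ?sqr_ge0// mulr_ge0// ltW.
rewrite big_split/= -!mulr_sumr -!sqr_enorm.
apply: (@le_trans _ _ ((a + b) / a * a ^+ 2 + (a + b) / b * b ^+ 2)).
  have [a1 b1] : 0 <= a /\ 0 <= b by split; exact: ltW.
  have ab : 0 <= a + b by exact: addr_ge0.
  have [xa yb] : enorm x <= a /\ enorm y <= b by rewrite /a /b; split; lra.
  apply: lerD; apply: ler_wpM2l; rewrite ?divr_ge0//.
  - by apply: lerXn2r; rewrite // nnegrE.
  - by apply: lerXn2r; rewrite // nnegrE.
rewrite le_eqVlt; apply/orP; left; apply/eqP; field.
by rewrite !lt0r_neq0.
Qed.

Lemma enormZ x z s : 0 <= s -> (forall i, tnth z i = s * tnth x i :> R) ->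
  enorm z = s * enorm x.
Proof.
move=> s0 zE; apply/eqP; rewrite -(@eqrXn2 _ 2) ?mulr_ge0 ?enorm_ge0//.
rewrite exprMn !sqr_enorm mulr_sumr; apply/eqP; apply: eq_bigr => i _.
by rewrite zE exprMn.
Qed.

Lemma enorm_eq0 x : enorm x = 0 -> x = origin.
Proof.
move=> x0; apply: eq_from_tnth => i; rewrite originE; apply/eqP.
rewrite -sqrf_eq0 eq_le sqr_ge0 andbT.
apply: (@le_trans _ _ (enorm x ^+ 2)); last by rewrite x0 expr0n.
rewrite sqr_enorm (bigD1 i)//= lerDl.
by rewrite sumr_ge0// => j _; exact: sqr_ge0.
Qed.

Lemma enorm_origin : enorm origin = 0.
Proof. by rewrite /enorm big1 ?sqrtr0// => i _; rewrite originE expr0n. Qed.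

(** Radius 0 does occur: a superlevel set of a radial decreasing function can shrink to the
    origin. *)
Lemma cballx0 c : cball c 0 = [set c].
Proof.
apply/seteqP; split => x; rewrite /cball/=.
  move=> x0; have /enorm_eq0 xc : enorm (tsub x c) = 0.
    by apply/eqP; rewrite eq_le x0 enorm_ge0.
  apply: eq_from_tnth => i; apply/eqP; rewrite -subr_eq0 -tsubE xc.
  by rewrite originE.
move=> ->; rewrite (_ : tsub c c = origin) ?enorm_origin//.
by apply: eq_from_tnth => i; rewrite tsubE originE subrr.
Qed.

Lemma measurable_enorm : measurable_fun setT (@enorm R d).
Proof.
apply: measurableT_comp.
  exact: continuous_measurable_fun (@sqrt_continuous R).
by apply: measurable_sum => i; apply: measurable_funX; exact: measurable_tnth.
Qed.

Lemma measurable_cball c r : measurable (cball c r).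
Proof.
have mt : measurable_fun setT (fun x => tsub x c).
  apply/measurable_fun_tnthP => i.
  rewrite (_ : _ \o _ = fun x => (tnth x i - tnth c i : R)); last first.
    by apply/funext => x /=; rewrite tsubE.
  by apply: measurable_funB => //; exact: measurable_tnth.
rewrite (_ : cball c r =
    (fun x => enorm (tsub x c)) @^-1` `]-oo, r]); last first.
  by apply/seteqP; split => x; rewrite /cball/= in_itv.
rewrite -[X in measurable X]setTI.
by apply: (measurableT_comp measurable_enorm mt) => //.
Qed.

(* With [k = (rho / s) ^ 2], expand
   [|y - k c|^2 = (1 - k) |y|^2 + k |y - c|^2 - k (1 - k) |c|^2]; as
   [rho ^ 2 = k s ^ 2], the first and last terms add up to at most 0. *)
Lemma cballI_subset c c' r rho s : 0 < s -> s <= enorm c -> 0 <= r ->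
  0 <= rho <= s -> (forall i, tnth c' i = (rho / s) ^+ 2 * tnth c i :> R) ->
  cball c r `&` cball origin rho `<=` cball c' (r * (rho / s)).
Proof.
move=> s0 sc r0 /andP[rho0 rhos] c'E y [].
have rs0 : 0 <= rho / s by rewrite divr_ge0// ltW.
have rrs0 : 0 <= r * (rho / s) by exact: mulr_ge0.
rewrite !cballE//.
under [X in _ -> X <= _ -> _]eq_bigr do rewrite originE subr0.
under [X in _ -> _ -> X <= _]eq_bigr do rewrite c'E.
set k := (rho / s) ^+ 2.
move=> yc y0.
have k0 : 0 <= k by rewrite /k sqr_ge0.
have k1 : k <= 1.
  by rewrite /k expr_le1 ?divr_ge0 ?(ltW s0)// ler_pdivrMr// mul1r.
have sc2 : s ^+ 2 <= \sum_(i < d) (tnth c i : R) ^+ 2.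
  by rewrite -sqr_enorm lerXn2r// nnegrE ?enorm_ge0// ltW.
have rhoE : rho ^+ 2 = k * s ^+ 2.
  by rewrite /k; field; exact: lt0r_neq0.
have -> : \sum_(i < d) ((tnth y i : R) - k * tnth c i) ^+ 2 =
    (1 - k) * (\sum_(i < d) (tnth y i : R) ^+ 2) +
    k * (\sum_(i < d) ((tnth y i : R) - tnth c i) ^+ 2) -
    k * (1 - k) * (\sum_(i < d) (tnth c i : R) ^+ 2).
  rewrite !mulr_sumr -big_split/= -sumrB; apply: eq_bigr => i _.
  by ring.
rewrite exprMn -/k.
have k1' : 0 <= 1 - k by rewrite subr_ge0.
rewrite rhoE in y0.
have := ler_wpM2l k1' y0; have := ler_wpM2l k0 yc.
have := ler_wpM2l (mulr_ge0 k0 k1') sc2.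
lra.
Qed.

End euclidean.
Arguments origin {R d}.

(** * Volumes of balls *)

Section volume.
Context {R : realType} {d : nat}.
Hypothesis d_gt0 : (0 < d)%N.
Implicit Types (c : Rspace R d) (r : R).
Local Notation mu := (lebesgue R d).

(** The value is never computed: it is finite and positive, and it cancels in the final
    estimates. *)
Definition unit_ball_volume : R := fine (mu (cball origin 1)).

Let box (e : R) : 0 <= e ->
  mu [set x | forall i, tnth x i \in `[(- e : R), e]] = ((2 * e) ^+ d)%:E.
Proof.
move=> e0; pose v (a : R) : Rspace R d := [tuple a | _ < d].
have vE a i : tnth (v a) i = a :> R by rewrite /v tnth_mktuple.
rewrite (_ : [set x | _] = [set x | forall i,
    tnth x i \in `[(tnth (v (- e)) i : R), tnth (v e) i]]); last first.
  by apply/seteqP; split => x /= h i; have := h i; rewrite !vE.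
rewrite lebesgue_box => [|i]; last by rewrite !vE ge0_cp.
congr EFin; rewrite (eq_bigr (fun=> 2 * e)) => [|i _].
  by rewrite prodr_const card_ord.
by rewrite !vE; lra.
Qed.

(** The unit ball lies in the cube [-1, 1]^d, so its measure is finite and [fine] loses nothing. *)
Lemma unit_ball_volumeE : mu (cball origin 1) = unit_ball_volume%:E.
Proof.
rewrite /unit_ball_volume fineK// ge0_fin_numE; last exact: measure_ge0.
apply: (@le_lt_trans _ _ (mu [set x | forall i, tnth x i \in `[(- 1 : R), 1]])).
  apply: le_lebesgue => x; rewrite cball0E/= => x1 i.
  rewrite in_itv/= -ler_norml -(@expr_le1 _ 2)// -normrX ger0_norm ?sqr_ge0//.
  rewrite enorm_le// expr1n in x1; apply: le_trans x1.
  by rewrite (bigD1 i)//= lerDl sumr_ge0// => j _; exact: sqr_ge0.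
by rewrite box// ltry.
Qed.

(** The unit ball contains the cube of half-side 1/d: there each squared coordinate is at most 1/d^2
    <= 1/d, and d of them add up to at most 1. *)
Lemma unit_ball_volume_gt0 : 0 < unit_ball_volume.
Proof.
rewrite -lte_fin -unit_ball_volumeE.
have e0 : 0 < (d%:R)^-1 :> R by rewrite invr_gt0 ltr0n.
apply: (@lt_le_trans _ _
    (mu [set x | forall i, tnth x i \in `[(- d%:R^-1 : R), d%:R^-1]])).
  by rewrite box ?lte_fin ?exprn_gt0 ?mulr_gt0// ltW.
apply: le_lebesgue => x /= xd; rewrite cball0E/= enorm_le// expr1n.
apply: (@le_trans _ _ (\sum_(i < d) d%:R^-1)).
  apply: ler_sum => i _; have := xd i; rewrite in_itv/= -ler_norml => xi.
  rewrite -[X in X <= _]ger0_norm ?sqr_ge0// normrX.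
  apply: le_trans (_ : d%:R^-1 ^+ 2 <= _).
    by rewrite lerXn2r// nnegrE// ltW.
  by rewrite expr2 ger_pMl// invf_le1 ?ltr0n// ler1n.
by rewrite sumr_const card_ord -[X in X <= _]mulr_natl mulfV// pnatr_eq0 -lt0n.
Qed.

(** A point is a box with a side of length zero. Positive dimension matters: in dimension 0 the only
    point has mass 1. *)
Lemma lebesgue_set1 c : mu [set c] = 0%E.
Proof.
apply/eqP; rewrite eq_le measure_ge0 andbT.
apply: (@le_trans _ _
    (mu [set x | forall i, tnth x i \in `[(tnth c i : R), tnth c i]])).
  by apply: le_lebesgue => _ -> i; rewrite in_itv/= lexx.
rewrite lebesgue_box// lee_fin (bigD1 (Ordinal d_gt0))//=.
by rewrite subrr mul0r.
Qed.

Lemma lebesgue_cball c r : 0 <= r ->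
  mu (cball c r) = (unit_ball_volume * r ^+ d)%:E.
Proof.
rewrite le_eqVlt => /predU1P[<-|r0].
  by rewrite cballx0 lebesgue_set1 expr0n gtn_eqF//= mulr0.
rewrite (@lebesgue_affine _ _ c r)//; last exact: measurable_cball.
rewrite mulrC EFinM -unit_ball_volumeE; congr (_ * mu _)%E.
apply/seteqP; split => x; rewrite /cball/= tsubx0.
all: rewrite (@enormZ _ _ x (tsub (taffine c r x) c) r) ?(ltW r0)//;
  last by move=> i; rewrite tsubE /taffine tnth_mktuple addrAC subrr add0r.
all: by rewrite -ler_pdivlMl// mulVf ?gt_eqF.
Qed.

End volume.

(** * The layer-cake formula *)

Section layer_cake.
Context d (T : measurableType d) (R : realType).
Variables (mu : {sigma_finite_measure set T -> \bar R}).
Variables (A : set T) (f : T -> R).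
Hypotheses (mA : measurable A) (mf : measurable_fun setT f).
Hypothesis f0 : forall x, 0 <= f x.

(** The region under the graph of [f] over [A]. Its section at a point of [A] is the interval [0, f
    x), and its section at height s >= 0 is a superlevel set. *)
Let E : set (T * measurableTypeR R) :=
  [set p | [/\ A p.1, 0 <= p.2 & p.2 < f p.1]].

Let mE : measurable E.
Proof.
rewrite (_ : E = (A `*` `[0, +oo[) `&` [set p | p.2 < f p.1]); last first.
  apply/seteqP; split => -[x s] /=; rewrite /E/= in_itv/= andbT; first by case.
  by case=> -[].
apply: measurableI; first exact: measurableX.
have mlt : measurable_fun setT (fun p : T * measurableTypeR R => p.2 < f p.1).
  apply: measurable_fun_ltr; first exact: measurable_snd.
  exact: measurableT_comp mf measurable_fst.
by have := mlt measurableT [set true] I; rewrite setTI.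
Qed.

Let ysectionE s : 0 <= s -> ysection E s = A `&` [set x | s < f x].
Proof.
move=> s0; apply/seteqP; split => x; rewrite /ysection/= inE/=; first by case.
by case.
Qed.

(** The restriction to s >= 0 is where these sets are the horizontal sections of [E]; below 0 those
    sections are empty. *)
Lemma measurable_superlevel : measurable_fun
  (`[0%R, +oo[%classic : set (measurableTypeR R))
  (fun s : measurableTypeR R => mu (A `&` [set x | s < f x])).
Proof.
apply: (eq_measurable_fun (mu \o ysection E)) => [s|].
  by rewrite inE/= in_itv/= andbT => s0; rewrite /= ysectionE.
by apply: measurable_funTS; exact: measurable_fun_ysection.
Qed.

(** Both sides are the product measure of [E], computed by Tonelli in the two orders of
    integration. *)
Lemma layer_cake :
  (\int[mu]_(x in A) (f x)%:E =
   \int[lebesgue_measure]_(s in `[0%R, +oo[)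
     mu (A `&` [set x | (s < f x)%R]))%E.
Proof.
have mE' : measurable_fun setT (fun p => (\1_E p)%:E : \bar R).
  by apply/measurable_EFinP; exact: measurable_indic.
transitivity (\int[mu]_x \int[lebesgue_measure]_s (\1_E (x, s))%:E)%E.
  rewrite integral_mkcond; apply: eq_integral => x _; rewrite patchE.
  rewrite (_ : (fun s => _) = fun s => (\1_(xsection E x) s)%:E); last first.
    by apply/funext => s; rewrite !indicE mem_xsection.
  rewrite integral_indic//= ?setIT; last exact: measurable_xsection.
  case: ifPn => [/set_mem Ax|/negP Ax].
    rewrite (_ : xsection E x = `[0, f x[%classic); last first.
      apply/seteqP; split => s; rewrite /xsection/= inE/= in_itv/=.
        by case=> _ -> ->.
      by move=> /andP[].
    rewrite lebesgue_measure_itv/= lte_fin sube0.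
    by case: ltgtP (f0 x) => // <-.
  rewrite (_ : xsection E x = set0) ?measure0//.
  by rewrite -subset0 => s; rewrite /xsection/= inE/= => -[/mem_set].
rewrite (fubini_tonelli (fun p => (\1_E p)%:E)); [|exact: mE'|]; last first.
  by move=> p; rewrite lee_fin indicE.
rewrite [RHS]integral_mkcond; apply: eq_integral => s _; rewrite patchE.
rewrite (_ : (fun x => _) = fun x => (\1_(ysection E s) x)%:E); last first.
  by apply/funext => x; rewrite !indicE mem_ysection.
rewrite integral_indic//= ?setIT; last exact: measurable_ysection.
case: ifPn => [|/negP].
  rewrite inE/= in_itv/= andbT => s0; by rewrite ysectionE.
rewrite inE/= in_itv/= andbT => s0.
rewrite (_ : ysection E s = set0) ?measure0//.
by rewrite -subset0 => x; rewrite /ysection/= inE/= => -[].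
Qed.

End layer_cake.

(** Integrating the hypothesis over s >= 0 gives the layer-cake expressions of both integrals. *)
Lemma ge0_integral_le_superlevel d (T : measurableType d) (R : realType)
    (mu : {sigma_finite_measure set T -> \bar R}) (A : set T) (f : T -> R)
    (k : R) :
  measurable A -> measurable_fun setT f -> (forall x, 0 <= f x) -> 0 <= k ->
  (forall s, 0 <= s ->
    (mu (A `&` [set x | s < f x]%R) <= k%:E * mu [set x | s < f x]%R)%E) ->
  (\int[mu]_(x in A) (f x)%:E <= k%:E * \int[mu]_x (f x)%:E)%E.
Proof.
move=> mA mf f0 k0 le_mu; rewrite !layer_cake//.
rewrite -ge0_integralZl_EFin//; last exact: measurable_superlevel.
apply: ge0_le_integral => //.
- exact: measurable_superlevel.
- by apply: measurable_funeM; exact: measurable_superlevel.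
- by move=> s; rewrite /= in_itv/= andbT => s0; rewrite setTI; exact: le_mu.
Qed.

(** Let [a] tend to 1 from below. This serves twice: for a supremum of radii that need not be
    attained, and for the sharp constant, which is only approached in the limit. *)
Lemma le_of_expr_le (R : realType) (d : nat) (x y : R) :
  (forall a, 0 < a < 1 -> a ^+ d * x <= y) -> x <= y.
Proof.
move=> h; rewrite leNgt; apply/negP => yx.
have xa : a ^+ d * x @[a --> (1 : R)^'-] --> x.
  suff : a ^+ d * x @[a --> (1 : R)^'-] --> (1 : R) ^+ d * x.
    by rewrite expr1n mul1r.
  apply: cvgMr_tmp; apply: cvg_at_left_filter; exact: exprn_continuous.
have : \forall a \near (1 : R)^'-, False.
  near=> a; have : a ^+ d * x <= y.
    apply: h; apply/andP; split; near: a; last exact: nbhs_left_lt.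
    by apply: nbhs_left_gt; exact: ltr01.
  by apply/negP; rewrite -ltNge; near: a; exact: (cvgr_gt _ xa).
by move/filter_ex => [].
Unshelve. all: by end_near.
Qed.

(** * Superlevel sets of radial decreasing functions *)

Section radial.
Context {R : realType} {d : nat}.
Hypothesis d_gt0 : (0 < d)%N.
Variables (g : Rspace R d -> R) (phi : R -> R).
Hypothesis phi_noninc : forall s s', 0 < s -> s <= s' -> phi s' <= phi s.
Hypothesis gE : forall x, x <> origin -> g x = phi (enorm x).
Hypothesis mg : measurable_fun setT g.
Local Notation mu := (lebesgue R d).
Local Notation omega := (@unit_ball_volume R d).

Let gE' x : 0 < enorm x -> g x = phi (enorm x).
Proof.
by move=> x0; apply: gE => xo; move: x0; rewrite xo enorm_origin ltxx.
Qed.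

Let E s := [set x | s < g x].

Let mE s : measurable (E s).
Proof.
have mlt : measurable_fun setT (fun x => s < g x).
  by apply: measurable_fun_ltr.
by have := mlt measurableT [set true] I; rewrite setTI.
Qed.

(** Monotonicity puts the ball of radius [rho] inside [E s], except possibly for the origin, where
    [g] is unconstrained; that point is null. *)
Let superlevel_ge s rho : 0 < rho -> s < phi rho ->
  ((omega * rho ^+ d)%:E <= mu (E s))%E.
Proof.
move=> rho0 srho; rewrite -(@lebesgue_cball _ _ d_gt0 origin) ?(ltW rho0)//.
apply: (@le_trans _ _ (mu (E s `|` [set origin]))).
  apply: le_lebesgue => x; rewrite cball0E/= => xrho.
  have [->|/eqP xo] := eqVneq x origin; [by right|left].
  rewrite /E/= (gE _ xo); apply: lt_le_trans srho _; apply: phi_noninc => //.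
  rewrite lt_neqAle enorm_ge0 andbT eq_sym; apply/eqP => /enorm_eq0; exact: xo.
have m0 : measurable [set origin : Rspace R d].
  by rewrite -cballx0; exact: measurable_cball.
apply: (@le_trans _ _ (mu (E s) + mu [set origin])%E); first exact: measureU2.
by rewrite lebesgue_set1// adde0.
Qed.

(** Up to a null set, [E s] is a ball centred at the origin; its radius is the supremum of the radii
    at which [phi] exceeds [s], and [phi S <= s] bounds these by [S]. *)
Let superlevel_le s S : 0 < S -> phi S <= s -> exists rho, [/\ 0 <= rho <= S,
  E s `<=` cball origin rho & ((omega * rho ^+ d)%:E <= mu (E s))%E].
Proof.
(* Including 0 keeps [X] nonempty when [phi] never exceeds [s], and covers the origin, where [g] may
   exceed [s] whatever [phi] is. *)
move=> S0 Ss; pose X := [set rho | rho = 0 \/ 0 < rho /\ s < phi rho].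
have XS : ubound X S.
  move=> rho [->|[rho0 srho]]; first exact: ltW.
  rewrite leNgt; apply/negP => /ltW/(phi_noninc _ _ S0) /(lt_le_trans srho).
  by rewrite ltNge Ss.
have X0 : X 0 by left.
have supX : has_sup X by split; [exists 0 | exists S].
exists (sup X); split.
- by rewrite ub_le_sup//= ?ge_sup//; [exists 0|exists S].
- move=> x; rewrite /E cball0E/= => sgx; apply: ub_le_sup; first by exists S.
  have [x0|x0] := leP (enorm x) 0.
    by left; apply/eqP; rewrite eq_le x0 enorm_ge0.
  by right; split => //; rewrite -gE'.
have sup0 : 0 <= sup X by apply: ub_le_sup => //; exists S.
have [->|] := eqVneq (mu (E s)) +oo%E; first by rewrite leey.
move=> /eqP muE; have muE' : mu (E s) \is a fin_num.
  by rewrite ge0_fin_numE ?measure_ge0// ltey; apply/eqP.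
(* The supremum may fail to belong to [X], so the bound is proved for the radius [a * sup X] with a
   < 1, which some element of [X] exceeds. *)
rewrite -(fineK muE') lee_fin; apply: (@le_of_expr_le _ d) => a /andP[a0 a1].
rewrite -lee_fin (fineK muE') mulrCA -exprMn.
have [supX0|supX0] := eqVneq (sup X) 0.
  by rewrite supX0 mulr0 expr0n gtn_eqF// mulr0 measure_ge0.
have supX_gt0 : 0 < sup X by rewrite lt_neqAle eq_sym supX0.
have : a * sup X < sup X by rewrite gtr_pMl.
move=> /(sup_gt supX.1)[rho Xrho arho].
have asup : 0 < a * sup X by exact: mulr_gt0.
apply: superlevel_ge => //; case: Xrho => [rho0|[_ srho]].
  by move: arho; rewrite rho0 ltNge ltW.
by apply: lt_le_trans srho _; apply: phi_noninc => //; exact: ltW.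
Qed.

Lemma lebesgue_cballI_superlevel c r S s : 0 < S -> S <= enorm c -> 0 <= r ->
  (mu (cball c r `&` [set x | s < g x]%R) <=
   ((r / S) ^+ d)%:E * mu [set x | s < g x]%R)%E.
Proof.
move=> S0 Sc r0; have rS0 : 0 <= (r / S) ^+ d.
  by rewrite exprn_ge0// divr_ge0// ltW.
have [sS|sS] := ltP s (phi S).
  (* Here the superlevel set has at least the volume of B(0, S), so bounding the intersection by the
     whole ball suffices. *)
  apply: (@le_trans _ _ (mu (cball c r))); first by apply: le_lebesgue => x [].
  apply: (@le_trans _ _ (((r / S) ^+ d)%:E * (omega * S ^+ d)%:E)%E).
    rewrite lebesgue_cball// -EFinM lee_fin mulrCA -exprMn divfK//.
    exact: lt0r_neq0.
  by apply: lee_wpmul2l; [rewrite lee_fin | exact: superlevel_ge].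
have [rho [/andP[rho0 rhoS] Esub muE]] := superlevel_le _ _ S0 sS.
(* The centre is the one required by [cballI_subset]; the ball around it has volume (r / S)^d |B(0,
   rho)|. *)
pose c' : Rspace R d := [tuple ((rho / S) ^+ 2 * tnth c i : R) | i < d].
have rrho0 : 0 <= r * (rho / S) by rewrite mulr_ge0// divr_ge0// ltW.
apply: (@le_trans _ _ (mu (cball c' (r * (rho / S))))).
  apply: le_lebesgue => x [xc xE].
  apply: (@cballI_subset _ _ c c' r rho S); rewrite ?rho0//.
    by move=> i; rewrite /c' tnth_mktuple.
  by split => //; exact: Esub.
rewrite lebesgue_cball//.
rewrite (_ : omega * _ = (r / S) ^+ d * (omega * rho ^+ d)); last first.
  by rewrite [RHS]mulrCA -exprMn; congr (_ * (_ ^+ d)); ring.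
by rewrite EFinM; apply: lee_wpmul2l; rewrite ?lee_fin.
Qed.

End radial.

(** * The weak-type bound and its sharpness *)

Section weak_type.
Context {R : realType} {d : nat}.
Hypothesis d_gt0 : (0 < d)%N.
Local Notation mu := (lebesgue R d).
Local Notation omega := (@unit_ball_volume R d).
Implicit Types (g : Rspace R d -> R) (c x : Rspace R d).

Lemma norm1E g : (forall x, 0 <= g x) ->
  norm1 g = (\int[mu]_x (g x)%:E)%E.
Proof.
by move=> g0; apply: eq_integral => x _; rewrite /= ger0_norm.
Qed.

Lemma averageE g c r : 0 < r -> average g (cball c r) =
  ((omega * r ^+ d)^-1%:E * \int[mu]_(y in cball c r) (g y)%:E)%E.
Proof.
move=> r0; rewrite /average lebesgue_cball ?(ltW r0)// inver.
by rewrite gt_eqF// mulr_gt0 ?unit_ball_volume_gt0// exprn_gt0.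
Qed.

(** With S = |x| / (1 + lam), the alternative on [r] and [c] is what the membership of x in lam B
    guarantees. *)
Lemma integral_cball_le g c r S : (forall x, 0 <= g x) ->
  radial_decreasing g -> measurable_fun setT g -> 0 < S -> 0 <= r ->
  S <= r \/ S <= enorm c ->
  (\int[mu]_(y in cball c r) (g y)%:E <= ((r / S) ^+ d)%:E * norm1 g)%E.
Proof.
move=> g0 [phi [_ phi_noninc gE]] mg S0 r0 rS.
have mg' : measurable_fun setT (EFin \o g) by exact/measurable_EFinP.
rewrite norm1E//; case: rS => [Sr|Sc].
  apply: (@le_trans _ _ (\int[mu]_x (g x)%:E)%E).
    apply: ge0_subset_integral => //; first exact: measurable_cball.
    by move=> x _; rewrite lee_fin.
  rewrite -[X in (X <= _)%E]mul1e; apply: lee_wpmul2r.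
    by apply: integral_ge0 => x _; rewrite lee_fin.
  by rewrite lee_fin exprn_ege1// ler_pdivlMr// mul1r.
apply: ge0_integral_le_superlevel => //; first exact: measurable_cball.
  by rewrite exprn_ge0// divr_ge0// ltW.
move=> s _; exact: (lebesgue_cballI_superlevel d_gt0
  _ _ phi_noninc gE mg _ _ _ _ S0 Sc r0).
Qed.

Lemma maximal_le (lam : R) g x : 0 <= lam ->
  (forall y, 0 <= g y) -> radial_decreasing g -> measurable_fun setT g ->
  0 < enorm x ->
  (maximal lam g x <=
   ((1 + lam) ^+ d / (omega * enorm x ^+ d))%:E * norm1 g)%E.
Proof.
move=> lam0 g0 rg mg x0; apply: ge_ereal_sup => _ [c [r [r0 xc ->]]].
have lam1 : 0 < 1 + lam by rewrite ltr_wpDr.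
pose S := enorm x / (1 + lam).
have S0 : 0 < S by rewrite divr_gt0.
have om0 : 0 < omega := unit_ball_volume_gt0 d_gt0.
(* Membership in lam B gives |x| <= |c| + lam r, so r < S forces |c| >= (1 + lam) S - lam S = S. *)
have rS : S <= r \/ S <= enorm c.
  have [|rS] := leP S r; [by left | right].
  have tri : enorm x <= enorm (tsub x c) + enorm c.
    by apply: enorm_triangle => i; rewrite tsubE subrK.
  have xE : enorm x = S + lam * S by rewrite /S; field; exact: lt0r_neq0.
  have lamrS : lam * r <= lam * S by rewrite ler_wpM2l// ltW.
  by move: xc; rewrite /cball/= => xc; lra.
rewrite averageE//.
apply: (@le_trans _ _
    ((omega * r ^+ d)^-1%:E * (((r / S) ^+ d)%:E * norm1 g))%E).
  apply: lee_wpmul2l; last by apply: integral_cball_le; rewrite ?(ltW r0).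
  by rewrite lee_fin invr_ge0 mulr_ge0 ?exprn_ge0 ?ltW.
rewrite muleA -EFinM (_ : _^-1 * _ = (1 + lam) ^+ d / (omega * enorm x ^+ d))//.
have -> : r / S = r * (1 + lam) / enorm x.
  by rewrite /S; field; rewrite !lt0r_neq0.
have : r ^+ d != 0 by rewrite expf_neq0// lt0r_neq0.
have : enorm x ^+ d != 0 by rewrite expf_neq0// lt0r_neq0.
rewrite !exprMn exprVn.
move: (r ^+ d) (enorm x ^+ d) ((1 + lam) ^+ d) => u v w v0 u0.
by field; rewrite u0 v0 lt0r_neq0.
Qed.

(** This supplies the radius of a ball of prescribed volume. *)
Lemma exists_root (y : R) : 0 <= y -> exists2 rho : R, 0 <= rho & rho ^+ d = y.
Proof.
move=> y0; exists (y `^ d%:R^-1); first exact: powR_ge0.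
rewrite -powR_mulrn ?powR_ge0// -powRrM mulVf ?powRr1//.
by rewrite pnatr_eq0 -lt0n.
Qed.

Lemma weak_type_bound (lam : R) g (t : R) : 0 <= lam ->
  (forall x, 0 <= g x) -> radial_decreasing g ->
  mu.-integrable setT (EFin \o g) -> 0 < t ->
  (mu [set x | t%:E < maximal lam g x]
     <= ((1 + lam) ^+ d / t)%:E * norm1 g)%E.
Proof.
move=> lam0 g0 rg ig t0.
have om0 : 0 < omega := unit_ball_volume_gt0 d_gt0.
have mg : measurable_fun setT g by apply/measurable_EFinP; case/integrableP: ig.
have I0 : (0 <= norm1 g)%E by exact: integral_ge0.
have Ifin : norm1 g \is a fin_num.
  by rewrite ge0_fin_numE//; case/integrableP: ig.
rewrite -(fineK Ifin); set I := fine _.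
have I0' : 0 <= I by exact: fine_ge0.
have lam1 : 0 <= (1 + lam) ^+ d by rewrite exprn_ge0// addr_ge0.
(* The radius is chosen so that B(0, rho) has volume exactly (1 + lam)^d |g|_1 / t. *)
have [] := @exists_root ((1 + lam) ^+ d / t * I / omega).
  apply: divr_ge0; last exact: ltW.
  by apply: mulr_ge0 => //; apply: divr_ge0 => //; exact: ltW.
move=> rho rho0 rhoE.
apply: (@le_trans _ _ (mu (cball origin rho))); last first.
  by rewrite lebesgue_cball// rhoE -EFinM lee_fin mulrC divfK// gt_eqF.
apply: le_lebesgue => x; rewrite cball0E/= => tx.
(* The bound of [maximal_le] divides by |x|; the origin lies in the ball anyway. *)
have [x0|x0] := leP (enorm x) 0; first exact: le_trans x0 rho0.
have := lt_le_trans tx (maximal_le _ _ _ lam0 g0 rg mg x0).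
rewrite -(fineK Ifin) -/I -EFinM lte_fin => tI.
rewrite -(@ler_pXn2r _ d)// ?nnegrE ?enorm_ge0// rhoE.
have xd0 : 0 < enorm x ^+ d by exact: exprn_gt0.
move: tI; rewrite mulrAC ltr_pdivlMr ?mulr_gt0//.
rewrite ler_pdivlMr// mulrAC ler_pdivlMr// => tI.
by apply: ltW; rewrite [ltLHS](_ : _ = t * (omega * enorm x ^+ d)); last ring.
Qed.

Let g1 : Rspace R d -> R := \1_(cball origin 1).

Let radial_g1 : radial_decreasing g1.
Proof.
exists (fun s => (s <= 1)%R%:R); split => [s _|s s' _ ss'|x _].
- by rewrite ler0n.
- by rewrite ler_nat; case: leP => // s'1; rewrite (le_trans ss' s'1).
- rewrite /g1 indicE cball0E (_ : (x \in _) = (enorm x <= 1))//.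
  by apply/idP/idP; rewrite inE.
Qed.

Let norm1_g1 : norm1 g1 = omega%:E.
Proof.
rewrite norm1E//.
rewrite /g1 integral_indic ?setIT//; first exact: unit_ball_volumeE.
exact: measurable_cball.
Qed.

Let maximal_g1 (lam rho : R) x : 0 <= lam -> 0 <= rho ->
  enorm x <= (1 + lam) * rho ->
  (((rho + 1) ^- d)%:E <= maximal lam g1 x)%E.
Proof.
move=> lam0 rho0 xrho; have lam1 : 0 < 1 + lam by rewrite ltr_wpDr.
have om0 : 0 < omega := unit_ball_volume_gt0 d_gt0.
have r0 : 0 < rho + 1 by rewrite ltr_wpDl.
pose c : Rspace R d := [tuple ((1 + lam)^-1 * tnth x i : R) | i < d].
have cE i : tnth c i = (1 + lam)^-1 * tnth x i :> R by rewrite /c tnth_mktuple.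
have nc : enorm c = (1 + lam)^-1 * enorm x.
  by apply: enormZ cE; rewrite invr_ge0 ltW.
have crho : enorm c <= rho by rewrite nc ler_pdivrMl.
apply: ereal_sup_ubound; exists c, (rho + 1); split => //.
  (* Since x - c = lam c, membership in lam B follows from |c| <= rho + 1. *)
  rewrite /cball/= (@enormZ _ _ c _ lam)//.
    by rewrite ler_wpM2l// (le_trans crho)// lerDl.
  by move=> i; rewrite tsubE cE; field; exact: lt0r_neq0.
rewrite averageE// /g1 integral_indic; [|exact: measurable_cball..].
rewrite (_ : _ `&` _ = cball origin 1); last first.
  apply: setIidl => y; rewrite cball0E/= => y1; rewrite /cball/=.
  have -> : rho + 1 = 1 + rho by rewrite addrC.
  have oc : enorm (tsub origin c) = enorm c.
    rewrite /enorm; congr Num.sqrt; apply: eq_bigr => i _.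
    by rewrite tsubE originE sub0r sqrrN.
  apply: le_trans (lerD y1 crho); rewrite -oc; apply: enorm_triangle => i.
  by rewrite !tsubE originE add0r.
transitivity ((omega * (rho + 1) ^+ d)^-1%:E * omega%:E)%E; last first.
  by congr (_ * _)%E; exact/esym/unit_ball_volumeE.
by rewrite -EFinM invfM mulrAC mulVf ?mul1r// gt_eqF.
Qed.

Lemma weak_type_sharp (lam C : R) : 0 <= lam ->
  (forall g, (forall x, 0 <= g x) -> radial_decreasing g ->
     mu.-integrable setT (EFin \o g) -> forall t : R, 0 < t ->
     (mu [set x | t%:E < maximal lam g x] <= (C / t)%:E * norm1 g)%E) ->
  (1 + lam) ^+ d <= C.
Proof.
move=> lam0 H; apply: (@le_of_expr_le _ d) => a /andP[a0 a1].
have om0 : 0 < omega := unit_ball_volume_gt0 d_gt0.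
have a1' : 0 < 1 - a by rewrite subr_gt0.
have lam1 : 0 <= 1 + lam by rewrite addr_ge0.
(* That is, [a = rho / (rho + 2)] and [t = (rho + 2)^-d]. *)
pose rho := 2 * a / (1 - a); pose t := ((1 - a) / 2) ^+ d.
have rho0 : 0 <= rho by rewrite divr_ge0 ?mulr_ge0 ?ltW.
have t0 : 0 < t by rewrite exprn_gt0// divr_gt0.
have ig1 : mu.-integrable setT (EFin \o g1).
  apply/integrableP; split.
    by apply/measurable_EFinP; apply: measurable_indic; exact: measurable_cball.
  by rewrite -/(norm1 g1) norm1_g1 ltry.
have g10 x : 0 <= g1 x by rewrite /g1 indicE.
have := H g1 g10 radial_g1 ig1 t t0; rewrite norm1_g1.
have lrho0 : 0 <= (1 + lam) * rho by exact: mulr_ge0.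
(* The level set is defined by a strict inequality, which is why [t] is built from rho + 2 and not
   from rho + 1. *)
have trho : t < (rho + 1) ^- d.
  rewrite -exprVn /t (_ : (rho + 1)^-1 = (1 - a) / (1 + a)); last first.
    rewrite /rho; field; do ?[apply/andP; split]; apply: lt0r_neq0; lra.
  have a2 : 0 < 1 + a by rewrite addr_gt0.
  rewrite ltr_pXn2r// ?nnegrE ?divr_ge0 ?(ltW a1') ?(ltW a2)//.
  by rewrite ltr_pM2l// ltf_pV2 ?posrE//; lra.
have sub : cball origin ((1 + lam) * rho) `<=`
    [set x | t%:E < maximal lam g1 x]%E.
  move=> x; rewrite cball0E/= => xrho.
  by apply: lt_le_trans (maximal_g1 _ _ _ lam0 rho0 xrho); rewrite lte_fin.
(* Cancelling [omega] leaves ((1 + lam) rho)^d t <= C, and rho^d t = a^d by the choice of [rho] and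
   [t]. *)
move/(le_trans (le_lebesgue _ _ _ _ sub)); rewrite lebesgue_cball//.
rewrite -EFinM lee_fin mulrC ler_pM2r// ler_pdivlMr//.
apply: le_trans; rewrite le_eqVlt; apply/orP; left; apply/eqP.
rewrite /t -exprMn [RHS]mulrC -!exprMn; congr (_ ^+ _).
by rewrite /rho; field; exact: lt0r_neq0.
Qed.

End weak_type.

Theorem theorem1 (R : realType) (d : nat) (lam : R)
    (hd : (1 <= d)%N) (hlam : 0 <= lam <= 1) :
  (forall g : Rspace R d -> R,
     (forall x, 0 <= g x) -> radial_decreasing g ->
     (lebesgue R d).-integrable setT (EFin \o g) ->
     forall t : R, 0 < t ->
     (lebesgue R d [set x | t%:E < maximal lam g x]
        <= ((1 + lam) ^+ d / t)%:E * norm1 g)%E)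
  /\
  (forall C : R,
     (forall g : Rspace R d -> R,
        (forall x, 0 <= g x) -> radial_decreasing g ->
        (lebesgue R d).-integrable setT (EFin \o g) ->
        forall t : R, 0 < t ->
        (lebesgue R d [set x | t%:E < maximal lam g x]
           <= (C / t)%:E * norm1 g)%E) ->
     (1 + lam) ^+ d <= C).
Proof.
case/andP: hlam => lam0 _; split; last by move=> C; exact: weak_type_sharp.
by move=> g g0 rg ig t; exact: weak_type_bound.
Qed.
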